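(* Let $\mathcal{I}(P_M,Q_N)$ be the ideal of a Hadamard fat grid. Then its resurgence is $\rho(\mathcal{I}(P_M,Q_N))=1$.
   Context: Let $\mathbb{K}$ be an algebraically closed field and $S=\mathbb{K}[x_0,x_1,x_2]$. The resurgence of a homogeneous ideal $0\neq I\subsetneq S$ is $\rho(I)=\sup\{a/b : a,b\geq 1,\ I^{(a)}\not\subseteq I^b\}$, where $I^{(a)}$ is the $a$-th symbolic power; for a fat point ideal $I=\bigcap_i I(R_i)^{c_i}$ with distinct points $R_i$, $I^{(a)}=\bigcap_i I(R_i)^{ac_i}$. For a point $P\in\mathbb{P}^2$, $I(P)\subset S$ is the ideal generated by all homogeneous polynomials vanishing at $P$; $\Delta_1$ is the union of the coordinate lines $x_i=0$ of $\mathbb{P}^2$. The Hadamard product of points is coordinatewise, $[p_0:p_1:p_2]\star[q_0:q_1:q_2]=[p_0q_0:p_1q_1:p_2q_2]$; for a line $\ell$ and a point $P\notin\Delta_1$, $\ell\star P$ is the line $\{L\star P: L\in\ell\}$. The Hadamard product of ideals $I,J\subset S$ is $I\star J=(I(\mathbf{y})+J(\mathbf{z})+\langle x_i-y_iz_i\mid i=0,1,2\rangle)\cap\mathbb{K}[x_0,x_1,x_2]$, where $I(\mathbf{y})$, $J(\mathbf{z})$ are the images of $I,J$ under $x_i\mapsto y_i$, $x_i\mapsto z_i$. Hadamard fat grid: let $\{P_1,\dots,P_r\}$ and $\{Q_1,\dots,Q_s\}$ be sets of distinct collinear points in $\mathbb{P}^2\setminus\Delta_1$, lying on lines $\ell_P$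 and $\ell_Q$ respectively, with positive integer multiplicities $M=\{m_1,\dots,m_r\}$ and $N=\{n_1,\dots,n_s\}$, where $r\leq s$, $m_1\leq\cdots\leq m_r$ and $n_1\leq\cdots\leq n_s$. Put $I(P_M)=\bigcap_i I(P_i)^{m_i}$, $I(Q_N)=\bigcap_j I(Q_j)^{n_j}$. Assume $P_i\star Q_j\neq P_k\star Q_l$ for all $1\leq i<k\leq r$, $1\leq j<l\leq s$. The set of fat points defined by $I(P_M)\star I(Q_N)$ is the Hadamard fat grid $HFG(P_M,Q_N)$; its ideal is $\mathcal{I}(P_M,Q_N)=\bigcap_{i=1}^r\bigcap_{j=1}^s I(P_i\star Q_j)^{m_i+n_j-1}$. Its support $\{P_i\star Q_j\}$ is a complete intersection of type $(r,s)$, i.e. it consists of $rs$ distinct points, the intersections $(\ell_Q\star P_i)\cap(\ell_P\star Q_j)=\{P_i\star Q_j\}$ of the $r$ distinct lines $\ell_Q\star P_i$ with the $s$ distinct lines $\ell_P\star Q_j$. *)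

(* Defs.v *)
From mathcomp Require Import all_boot all_order all_algebra.
From mathcomp Require Import mpoly.
From mathcomp Require Import classical_sets reals constructive_ereal ereal.

Set Implicit Arguments.
Unset Strict Implicit.
Unset Printing Implicit Defensive.

Import Order.TTheory GRing.Theory Num.Theory.
Local Open Scope classical_set_scope.
Local Open Scope ring_scope.

(* Ideals are represented by their underlying sets of elements. *)

Definition is_ideal (A : comNzRingType) (I : set A) : Prop :=
  [/\ I 0, forall f g, I f -> I g -> I (f + g) & forall f g, I g -> I (f * g)].

Definition is_prime_ideal (A : comNzRingType) (p : set A) : Prop :=
  [/\ is_ideal p, ~ p 1 & forall f g, p (f * g) -> p f \/ p g].

Definition ideal_gen (A : comNzRingType) (G : set A) : set A :=
  [set f | exists (k : nat) (c g : 'I_k -> A),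
     (forall t, G (g t)) /\ f = \sum_t c t * g t].

(* For n = 0 the generating set is [set 1], so I^0 is the unit ideal. *)
Definition ideal_pow (A : comNzRingType) (I : set A) (n : nat) : set A :=
  ideal_gen [set f | exists g : 'I_n -> A,
     (forall t, I (g t)) /\ f = \prod_t g t].

Definition colon (A : comNzRingType) (I : set A) (g : A) : set A :=
  [set f | I (f * g)].

Definition associated_prime (A : comNzRingType) (I p : set A) : Prop :=
  is_prime_ideal p /\ exists g, p = colon I g.

(* I^(a) is the intersection over p in Ass(A/I) of the contractions to A of
   I^a A_p; an element f of a domain A lies in I^a A_p iff s f lies in I^a for
   some s outside p. *)
Definition symbolic_pow (A : idomainType) (I : set A) (a : nat) : set A :=
  [set f | forall p, associated_prime I p ->
     exists s, ~ p s /\ ideal_pow I a (s * f)].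

(* The supremum is taken in the extended reals, where it always exists. *)
Definition resurgence (R : realType) (A : idomainType) (I : set A) : \bar R :=
  ereal_sup [set x | exists a b : nat,
    [/\ (1 <= a)%N, (1 <= b)%N,
        ~ (symbolic_pow I a `<=` ideal_pow I b)
      & x = (a%:R / b%:R : R)%:E]].

(* A point of P^2 is given by any nonzero vector of homogeneous coordinates,
   and equality of points is proj_eq; a subset of P^2 is given by the set of
   all the representatives of its points. *)

Definition proj_eq (K : fieldType) (u v : 'rV[K]_3) : Prop :=
  exists c : K, c != 0 /\ u = c *: v.

Definition off_Delta1 (K : fieldType) (v : 'rV[K]_3) : Prop :=
  forall i, v 0 i != 0.

Definition is_line (K : fieldType) (l : set 'rV[K]_3) : Prop :=
  exists a : 'rV[K]_3, a != 0 /\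
    l = [set v : 'rV[K]_3 | v != 0 /\ \sum_i a 0 i * v 0 i = 0].

(* On points outside Delta_1, or on one point outside Delta_1 and an arbitrary
   one, this is the Hadamard product of points of P^2. *)
Definition hprod (K : fieldType) (p q : 'rV[K]_3) : 'rV[K]_3 :=
  \row_i (p 0 i * q 0 i).

Definition hline (K : fieldType) (l : set 'rV[K]_3) (p : 'rV[K]_3) :
    set 'rV[K]_3 :=
  [set hprod v p | v in l].

Definition point_ideal (K : fieldType) (p : 'rV[K]_3) : set {mpoly K[3]} :=
  ideal_gen [set f | (exists d, f \is d.-homog) /\ f.@[fun i => p 0 i] = 0].

(* The support { P_i * Q_j } is a complete intersection of type (r, s), cut out
   by the lines lQ * P_i and lP * Q_j. *)
Definition ci_support (K : fieldType) (r s : nat)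
    (P : 'I_r -> 'rV[K]_3) (Q : 'I_s -> 'rV[K]_3)
    (lP lQ : set 'rV[K]_3) : Prop :=
  [/\ injective (fun i => hline lQ (P i)),
      injective (fun j => hline lP (Q j)),
      forall i j k l,
        proj_eq (hprod (P i) (Q j)) (hprod (P k) (Q l)) -> i = k /\ j = l
    & forall i j, hline lQ (P i) `&` hline lP (Q j) =
                  [set v | proj_eq v (hprod (P i) (Q j))]].

(* hfg_sep alone does not imply hfg_ci: for Q = P it allows
   P_1 * Q_2 = P_2 * Q_1, and even pairwise distinct products P_i * Q_j need
   not form a complete intersection of type (r, s). *)
Record hadamard_fat_grid (K : fieldType) (r s : nat)
    (P : 'I_r -> 'rV[K]_3) (Q : 'I_s -> 'rV[K]_3)
    (lP lQ : set 'rV[K]_3) (m : 'I_r -> nat) (n : 'I_s -> nat) : Prop := {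
  hfg_r_gt0 : (0 < r)%N;
  hfg_le_rs : (r <= s)%N;
  hfg_lineP : is_line lP;
  hfg_lineQ : is_line lQ;
  hfg_P_on : forall i, lP (P i);
  hfg_Q_on : forall j, lQ (Q j);
  hfg_P_off : forall i, off_Delta1 (P i);
  hfg_Q_off : forall j, off_Delta1 (Q j);
  hfg_P_distinct : forall i k, proj_eq (P i) (P k) -> i = k;
  hfg_Q_distinct : forall j l, proj_eq (Q j) (Q l) -> j = l;
  hfg_m_gt0 : forall i, (0 < m i)%N;
  hfg_n_gt0 : forall j, (0 < n j)%N;
  hfg_m_mono : forall i k : 'I_r, (i <= k)%N -> (m i <= m k)%N;
  hfg_n_mono : forall j l : 'I_s, (j <= l)%N -> (n j <= n l)%N;
  hfg_sep : forall (i k : 'I_r) (j l : 'I_s), (i < k)%N -> (j < l)%N ->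
    ~ proj_eq (hprod (P i) (Q j)) (hprod (P k) (Q l));
  hfg_ci : ci_support P Q lP lQ
}.

Definition hfg_ideal (K : fieldType) (r s : nat)
    (P : 'I_r -> 'rV[K]_3) (Q : 'I_s -> 'rV[K]_3)
    (m : 'I_r -> nat) (n : 'I_s -> nat) : set {mpoly K[3]} :=
  [set f | forall i j,
     ideal_pow (point_ideal (hprod (P i) (Q j))) (m i + n j - 1)%N f].

(* Main.v *)
(* With p i = m i + N and w j = N + 1 - n j, where N is the sum
   of the n j, the multiplicity m i + n j - 1 is
   p i - w j. Let L i and M j be linear forms of the two families of lines. The
   truncated differences p i - w j describe the ideal of the fat points as the
   ideal generated by the products
     G_u = prod_i (L i)^(p i - u) * prod_j (M j)^(u - w j),   u = 0, 1, ...
   Indeed, take i with p i maximal: modulo L i, an element f of the ideal is a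
   multiple of prod_j (M j)^(p i - w j) = G_(p i), and dividing the difference
   by L i gives an element of the ideal obtained by lowering p i by one.
   The a-th symbolic power is the ideal attached to a p and a w, whose
   generators are products of a generators of the form G_k or G_(k + 1). Hence
   symbolic and ordinary powers coincide, and the order of vanishing at a point
   separates the a-th power from the (a + 1)-st.

   The multiplicity of f at the point R is measured by the T-adic order of
   f(s R + T x), where s and T are new variables and x is the generic vector. *)
From HB Require Import structures.
Require Import Defs.
From mathcomp Require Import all_boot all_order all_algebra.
From mathcomp Require Import mpoly.
From mathcomp Require Import classical_sets reals constructive_ereal ereal.
From mathcomp Require Import zify ring lra.

Set Implicit Arguments.
Unset Strict Implicit.
Unset Printing Implicit Defensive.

Import Order.TTheory GRing.Theory Num.Theory.

(** * Ideals and their ordinary powers *)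

Section Ideals.

Local Open Scope ring_scope.
Variable A : comNzRingType.
Implicit Types (I G : set A) (f g : A).

Lemma is_ideal_sum I : is_ideal I ->
  forall (T : Type) (s : seq T) (Q : pred T) (F : T -> A),
  (forall t, Q t -> I (F t)) -> I (\sum_(t <- s | Q t) F t).
Proof. by case=> I0 ID _ T s Q F IF; elim/big_ind: _. Qed.

Lemma is_ideal_opp I f : is_ideal I -> I f -> I (- f).
Proof. by case=> _ _ IM If; rewrite -mulN1r; apply: IM. Qed.

Lemma is_idealB I f g : is_ideal I -> I f -> I g -> I (f - g).
Proof. by move=> iI If Ig; have [_ ID _] := iI; apply: ID => //; apply: is_ideal_opp. Qed.

Lemma mul_preim_ideal I l : is_ideal I -> is_ideal [set f | I (l * f)]%classic.
Proof.
case=> I0 ID IM; split=> /= [|f g If Ig|f g Ig]; first by rewrite mulr0.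
  by rewrite mulrDr; apply: ID.
by rewrite mulrCA; apply: IM.
Qed.

Lemma ideal_gen_ideal G : is_ideal (ideal_gen G).
Proof.
split.
- by exists 0%N, (fun=> 0), (fun=> 0); rewrite big_ord0; split=> // -[].
- move=> _ _ [k [c [g [Gg ->]]]] [l [d [h [Gh ->]]]].
  pose glue (u : 'I_k -> A) (v : 'I_l -> A) (t : 'I_(k + l)) :=
    match split t with inl i => u i | inr j => v j end.
  have glueL u v i : glue u v (lshift l i) = u i.
    by rewrite /glue (unsplitK (inl i)).
  have glueR u v j : glue u v (rshift k j) = v j.
    by rewrite /glue (unsplitK (inr j)).
  exists (k + l)%N, (glue c d), (glue g h); split.
    by move=> t; rewrite /glue; case: split.
  by rewrite big_split_ord; congr (_ + _); apply: eq_bigr => t _;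
    rewrite ?glueL ?glueR.
- move=> f _ [k [c [g [Gg ->]]]]; exists k, (fun t => f * c t), g; split=> //.
  by rewrite mulr_sumr; apply: eq_bigr => t _; rewrite mulrA.
Qed.

Lemma ideal_gen_incl G f : G f -> ideal_gen G f.
Proof.
by move=> Gf; exists 1%N, (fun=> 1), (fun=> f); rewrite big_ord1 mul1r.
Qed.

Lemma ideal_gen_min G I : is_ideal I -> (G `<=` I)%classic ->
  (ideal_gen G `<=` I)%classic.
Proof.
move=> iI GI _ [k [c [g [Gg ->]]]]; apply: is_ideal_sum => // t _.
by have [_ _ IM] := iI; apply/IM/GI.
Qed.

Lemma ideal_pow_ideal I a : is_ideal (ideal_pow I a).
Proof. exact: ideal_gen_ideal. Qed.

Lemma ideal_pow_prod I a (g : 'I_a -> A) :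
  (forall t, I (g t)) -> ideal_pow I a (\prod_t g t).
Proof. by move=> Ig; apply: ideal_gen_incl; exists g. Qed.

Lemma ideal_pow_exp I a f : I f -> ideal_pow I a (f ^+ a).
Proof.
move=> If; have := @ideal_pow_prod I a (fun=> f) (fun=> If).
by rewrite prodr_const card_ord.
Qed.

Lemma ideal_powM I a b f g :
  ideal_pow I a f -> ideal_pow I b g -> ideal_pow I (a + b) (f * g).
Proof.
move=> fIa gIb.
have J1 := mul_preim_ideal _ (ideal_pow_ideal I (a + b)).
suff : (ideal_pow I a `<=` [set f | ideal_pow I (a + b) (g * f)])%classic.
  by move=> /(_ _ fIa); rewrite /= mulrC.
apply: ideal_gen_min => // _ [u [Iu ->]] /=; rewrite mulrC; move: g gIb.
apply: (ideal_gen_min (J1 _)) => _ [v [Iv ->]] /=.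
apply: ideal_gen_incl; exists (fun t => match split t with inl i => u i | inr j => v j end).
split; first by move=> t; case: split.
rewrite big_split_ord; congr (_ * _); apply: eq_bigr => t _.
  by rewrite (unsplitK (inl t)).
by rewrite (unsplitK (inr t)).
Qed.

Lemma ideal_pow_sub I a b : (b <= a)%N ->
  (ideal_pow I a `<=` ideal_pow I b)%classic.
Proof.
move=> le_ba; apply: ideal_gen_min; first exact: ideal_pow_ideal.
move=> _ [u [Iu ->]]; rewrite -(subnKC le_ba) in u Iu *.
rewrite big_split_ord /= mulrC; have [_ _ IM] := ideal_pow_ideal I b.
by apply: IM; apply: ideal_pow_prod.
Qed.

End Ideals.

(** * Divisibility by powers of X over a domain *)

Section XOrder.

Local Open Scope ring_scope.
Variable D : idomainType.
Implicit Types (p q : {poly D}) (c d : nat).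

Definition xord c p := exists q, p = q * 'X^c.

(** The zero polynomial has no exact order; over a domain exact orders add. *)
Definition xord_exact c p := exists2 q, p = q * 'X^c & q`_0 != 0.

Lemma xord0 p : xord 0 p.
Proof. by exists p; rewrite mulr1. Qed.

Lemma xord1P p : xord 1 p <-> p`_0 = 0.
Proof.
split=> [[q ->]|p0]; first by rewrite expr1 coefMX.
exists (drop_poly 1 p); rewrite -{1}(poly_take_drop 1 p).
rewrite (_ : take_poly 1 p = 0) ?add0r //.
by apply/polyP=> -[|i]; rewrite coef_take_poly coef0.
Qed.

Lemma xord_ideal c : is_ideal (xord c : set {poly D}).
Proof.
split=> [|_ _ [p ->] [q ->]|p _ [q ->]].
- by exists 0; rewrite mul0r.
- by exists (p + q); rewrite mulrDl.
- by exists (p * q); rewrite mulrA.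
Qed.

Lemma xord_sub c d p : (d <= c)%N -> xord c p -> xord d p.
Proof.
by move=> le_dc [q ->]; exists (q * 'X^(c - d)); rewrite -mulrA -exprD subnK.
Qed.

Lemma xordM c d p q : xord c p -> xord d q -> xord (c + d) (p * q).
Proof. by move=> [u ->] [v ->]; exists (u * v); rewrite exprD mulrACA. Qed.

Lemma xord_exactW c p : xord_exact c p -> xord c p.
Proof. by case=> q -> _; exists q. Qed.

Lemma xord_exactM c d p q :
  xord_exact c p -> xord_exact d q -> xord_exact (c + d) (p * q).
Proof.
move=> [u -> u0] [v -> v0]; exists (u * v); first by rewrite exprD mulrACA.
by rewrite coef0M mulf_neq0.
Qed.

(** X is prime and [p] absorbs exactly [e] factors X, so the remaining ones divide [q]. *)
Lemma xord_cancel c e p q : xord_exact e p -> xord c (p * q) -> xord (c - e) q.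
Proof.
case=> {}p -> p0; elim: c e q => [|c IHc] [|e] q [u]; try by exists q; rewrite mulr1.
  (* Case [e = 0]: the constant coefficient of [p] is nonzero, so that of [q] vanishes and one X
     splits off [q]. *)
  rewrite mulr1 => pq; have /xord1P[v qv] : q`_0 = 0.
    apply: (mulfI p0); rewrite mulr0 -coef0M pq exprS mulrA mulrAC.
    by rewrite coefMX.
  rewrite subn0 qv -addn1; apply: xordM; last by exists 1; rewrite mul1r.
  rewrite -[c]subn0; apply: (IHc 0); exists u.
  apply: (mulIf (x := 'X)); first by rewrite polyX_eq0.
  by rewrite mulr1 -mulrA -[v * 'X]qv pq exprSr mulrA.
rewrite subSS => pq; apply: IHc; exists u.
apply: (mulIf (x := 'X)); first by rewrite polyX_eq0.
by rewrite mulrAC -[p * _ * _]mulrA -exprSr pq exprSr mulrA.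
Qed.

End XOrder.

(** * The resurgence from a comparison of powers *)

Section Resurgence.

Local Open Scope ring_scope.

(** A failing containment forces a < b, so all ratios stay below 1, and the pairs (k, k + 1) give
    ratios tending to 1. *)
Lemma resurgence_eq1 (R : realType) (A : idomainType) (I : set A) :
  (forall a, (0 < a)%N -> symbolic_pow I a `<=` ideal_pow I a)%classic ->
  (forall a, (0 < a)%N -> ~ (symbolic_pow I a `<=` ideal_pow I a.+1)%classic) ->
  resurgence R I = 1%E.
Proof.
move=> symb nsymb; apply/eqP; rewrite eq_le; apply/andP; split.
  apply: ge_ereal_sup => _ [a [b [a0 b0 nab ->]]]; rewrite lee_fin.
  rewrite ler_pdivrMr ?ltr0n // mul1r ler_nat leqNgt; apply/negP => lt_ba.
  apply: nab => f /(symb _ a0); apply: ideal_pow_sub; exact: ltnW.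
apply/lee_subgt0Pr => e e0.
(* For k > 1/e the gap 1 - k/(k + 1) = 1/(k + 1) is below e. *)
have [k k0 ke] : exists2 k : nat, (0 < k)%N & e^-1 < k%:R.
  by exists (Num.truncn e^-1).+1; rewrite ?truncnS_gt.
apply: (@le_trans _ _ (k%:R / k.+1%:R : R)%:E).
  rewrite lee_fin ler_pdivlMr ?ltr0n // -natr1 mulrBl mul1r mulrDr mulr1.
  have : 1 < e * k%:R by rewrite mulrC -ltr_pdivrMr // div1r.
  by lra.
by apply: ereal_sup_ubound; exists k, k.+1; split=> //; apply: nsymb.
Qed.

End Resurgence.

(** * Linear forms and the order of vanishing at a point *)

Section LinearForms.

Local Open Scope ring_scope.
Variable K : fieldType.
Local Notation A := {mpoly K[3]}.
Implicit Types (R L M : 'rV[K]_3) (v : 'I_3 -> A) (f g : A).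

Lemma rmorph_mmap (S T : comNzRingType) (h : {rmorphism K -> S})
    (u : 'I_3 -> S) (e : {rmorphism S -> T}) f :
  e (mmap h u f) = mmap (e \o h) (e \o u) f.
Proof.
rewrite /mmap rmorph_sum; apply: eq_bigr => k _.
rewrite rmorphM /mmap1 rmorph_prod; congr (_ * _).
by apply: eq_bigr => i _; rewrite rmorphXn.
Qed.

Lemma eq_mmap (S : comNzRingType) (h h' : K -> S) (u u' : 'I_3 -> S) f :
  h =1 h' -> u =1 u' -> mmap h u f = mmap h' u' f.
Proof.
move=> eh eu; apply: eq_bigr => k _; rewrite eh; congr (_ * _).
by apply: eq_bigr => i _; rewrite eu.
Qed.

Definition dot L R : K := \sum_i L 0 i * R 0 i.

Definition lform L : A := \sum_i L 0 i *: 'X_i.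

Lemma mmap_lform (S : comNzRingType) (h : {rmorphism K -> S}) (u : 'I_3 -> S) L :
  mmap h u (lform L) = \sum_i h (L 0 i) * u i.
Proof. by rewrite raddf_sum; apply: eq_bigr => i _; rewrite /= mmapZ mmapX mmap1U. Qed.

Lemma lform_neq0 L : L != 0 -> lform L != 0.
Proof.
apply: contraNneq => L0; apply/eqP/rowP => i; rewrite mxE.
have := congr1 (fun p : A => p@_U_(i)) L0.
rewrite mcoeff0 raddf_sum (bigD1 i) //= mcoeffZ mcoeffXU eqxx mulr1.
rewrite big1 ?addr0 // => j ji.
by rewrite mcoeffZ mcoeffXU (negbTE ji) mulr0.
Qed.

Lemma lform_homog L : lform L \is 1.-homog.
Proof.
by apply: rpred_sum => i _; apply: rpredZ; rewrite dhomogX /= mdeg1.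
Qed.

(* f |-> f(s R + T v), a polynomial in T over A[s] *)
Definition line_subst R v : A -> {poly {poly A}} :=
  mmap (polyC \o (polyC \o @mpolyC 3 K))
       (fun i => ((R 0 i)%:MP%:P * 'X)%:P + (v i)%:P%:P * 'X).

HB.instance Definition _ R v := GRing.RMorphism.copy (line_subst R v)
  (mmap (polyC \o (polyC \o @mpolyC 3 K))
       (fun i => ((R 0 i)%:MP%:P * 'X)%:P + (v i)%:P%:P * 'X)).

Lemma line_substD R v : {morph line_subst R v : f g / f + g}.
Proof. exact: rmorphD. Qed.

Lemma line_substM R v : {morph line_subst R v : f g / f * g}.
Proof. exact: rmorphM. Qed.

(** This is f(s R), the part of f(s R + T v) free of T. It tests vanishing on the whole line spanned
    by [R], so it also makes sense for inhomogeneous f. *)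
Definition cone R : A -> {poly A} :=
  mmap (polyC \o @mpolyC 3 K) (fun i => (R 0 i)%:MP%:P * 'X).

HB.instance Definition _ R := GRing.RMorphism.copy (cone R)
  (mmap (polyC \o @mpolyC 3 K) (fun i => (R 0 i)%:MP%:P * 'X)).

Lemma line_subst_coef0 R v f : (line_subst R v f)`_0 = cone R f.
Proof.
rewrite -horner_coef0 -[_.[0]]/(horner_eval 0 (line_subst R v f)).
rewrite rmorph_mmap; apply: eq_mmap => i /=.
  by rewrite /horner_eval hornerC.
by rewrite /horner_eval !hornerE.
Qed.

Lemma mmap_affine_lform (B : comNzRingType) (h : {rmorphism K -> B}) (s : B)
    (u : 'I_3 -> B) R L :
  mmap (polyC \o h) (fun i => (h (R 0 i) * s)%:P + (u i)%:P * 'X) (lform L) =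
    (h (dot L R) * s)%:P + (\sum_i h (L 0 i) * u i)%:P * 'X.
Proof.
rewrite mmap_lform rmorph_sum mulr_suml !rmorph_sum mulr_suml -big_split.
by apply: eq_bigr => i _ /=; rewrite mulrDr !rmorphM /= !mulrA.
Qed.

Lemma line_subst_lform R v L :
  line_subst R v (lform L) =
    ((dot L R)%:MP%:P * 'X)%:P + (\sum_i (L 0 i)%:MP * v i)%:P%:P * 'X.
Proof.
have := mmap_affine_lform (polyC \o @mpolyC 3 K) 'X (fun i => (v i)%:P) R L.
rewrite /line_subst => -> /=; congr (_ + _%:P * 'X).
by rewrite rmorph_sum; apply: eq_bigr => i _; rewrite rmorphM.
Qed.

Lemma cone_lform R L : cone R (lform L) = (dot L R)%:MP%:P * 'X.
Proof.
by rewrite -(line_subst_coef0 R (fun=> 0)) line_subst_lform coefD coefMX coefC addr0.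
Qed.

(** By homogeneity f(s R) = f(R) s^d. *)
Lemma cone_homog R d f : f \is d.-homog -> f.@[fun i => R 0 i] = 0 -> cone R f = 0.
Proof.
move=> /dhomogP fd fR; pose h : {rmorphism K -> {poly A}} := (polyC \o @mpolyC 3 K).
suff -> : cone R f = h (f.@[fun i => R 0 i]) * 'X^d by rewrite fR rmorph0 mul0r.
rewrite /cone /mmap mevalE raddf_sum mulr_suml; apply: eq_big_seq => m /fd <-.
rewrite /= 2!rmorphM -mulrA /=; congr (_ * _).
rewrite mdegE expr_sum /mmap1 -[RHS]/(h _ * _) rmorph_prod -big_split.
by apply: eq_bigr => i _ /=; rewrite exprMn !rmorphXn.
Qed.

Lemma cone_eval R f (w : A) : cone R f = 0 ->
  mmap (@mpolyC 3 K) (fun i => (R 0 i)%:MP * w) f = 0.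
Proof.
move=> /(congr1 (horner_eval w)); rewrite rmorph0 => <-.
rewrite rmorph_mmap; apply: eq_mmap => i /=.
  by rewrite /horner_eval hornerC.
by rewrite /horner_eval !hornerE.
Qed.

(** The direction [v] is a parameter: the generic vector gives the multiplicity at [R], a vector
    along a line gives the order of the restriction to that line. *)
Definition ord R v c f := xord c (line_subst R v f).
Definition ord_exact R v c f := xord_exact c (line_subst R v f).

Lemma ord0 R v f : ord R v 0 f.
Proof. exact: xord0. Qed.

Lemma ord1P R v f : ord R v 1 f <-> cone R f = 0.
Proof. by rewrite /ord xord1P line_subst_coef0. Qed.

Lemma ord_ideal R v c : is_ideal (ord R v c : set A).
Proof.
have [x0 xD xM] := xord_ideal {poly A} c.
rewrite /ord; split=> [|f g|f g]; rewrite ?rmorph0 ?rmorphD ?rmorphM //.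
  exact: xD.
exact: xM.
Qed.

Lemma ord_sub R v c d f : (d <= c)%N -> ord R v c f -> ord R v d f.
Proof. exact: xord_sub. Qed.

Lemma ordM R v c d f g : ord R v c f -> ord R v d g -> ord R v (c + d) (f * g).
Proof. by rewrite /ord rmorphM; apply: xordM. Qed.

Lemma ord_exactW R v c f : ord_exact R v c f -> ord R v c f.
Proof. exact: xord_exactW. Qed.

Lemma ord_exactM R v c d f g :
  ord_exact R v c f -> ord_exact R v d g -> ord_exact R v (c + d) (f * g).
Proof. by rewrite /ord_exact rmorphM; apply: xord_exactM. Qed.

Lemma ord_cancel R v c e f g :
  ord_exact R v e f -> ord R v c (f * g) -> ord R v (c - e) g.
Proof. by rewrite /ord rmorphM; apply: xord_cancel. Qed.

Lemma ord_exact0P R v f : ord_exact R v 0 f <-> cone R f != 0.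
Proof.
rewrite /ord_exact -(line_subst_coef0 R v); split=> [[q ->]|]; first by rewrite mulr1.
by exists (line_subst R v f); rewrite ?mulr1.
Qed.

Lemma ord_exact1 R v : ord_exact R v 0 1.
Proof. by apply/ord_exact0P; rewrite rmorph1 oner_neq0. Qed.

Lemma ord_exactX R v c n f : ord_exact R v c f -> ord_exact R v (c * n) (f ^+ n).
Proof.
move=> ef; elim: n => [|n IHn]; first by rewrite muln0; apply: ord_exact1.
by rewrite mulnS exprS; apply: ord_exactM.
Qed.

Lemma ord_prod R v c n (g : 'I_n -> A) :
  (forall t, ord R v c (g t)) -> ord R v (n * c) (\prod_t g t).
Proof.
elim: n g => [|n IHn] g og; first exact: ord0.
by rewrite big_ord_recl mulSn; apply: ordM => //; apply: IHn.
Qed.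

Lemma ord_exact_prod0 R v (I : finType) (Q : pred I) (F : I -> A) :
  (forall i, Q i -> ord_exact R v 0 (F i)) -> ord_exact R v 0 (\prod_(i | Q i) F i).
Proof.
move=> eF; apply: (big_ind (ord_exact R v 0)); [exact: ord_exact1 | | exact: eF].
move=> f g ef eg; exact: (ord_exactM ef eg).
Qed.

Lemma ord_exact_lform0 R v L : dot L R != 0 -> ord_exact R v 0 (lform L).
Proof.
move=> LR; apply/ord_exact0P; rewrite cone_lform mulf_neq0 ?polyX_eq0 //.
by rewrite polyC_eq0 mpolyC_eq0.
Qed.

Lemma ord_exact_lform1 R v L : dot L R = 0 -> \sum_i (L 0 i)%:MP * v i != 0 ->
  ord_exact R v 1 (lform L).
Proof.
move=> LR Lv; rewrite /ord_exact line_subst_lform LR polyC0 mul0r add0r.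
by exists (\sum_i (L 0 i)%:MP * v i)%:P%:P; rewrite ?expr1 // coefC polyC_eq0.
Qed.

Lemma ord_exact_lform1_generic R L : dot L R = 0 -> L != 0 ->
  ord_exact R (fun i => 'X_i) 1 (lform L).
Proof.
move=> LR L0; apply: ord_exact_lform1 => //.
apply: contra_neq (lform_neq0 L0) => <-; apply: eq_bigr => i _.
by rewrite mul_mpolyC.
Qed.

(** Substituting [v] for the variables in the coefficients preserves divisibility by T^c. *)
Lemma ord_specialize R v c f : ord R (fun i => 'X_i) c f -> ord R v c f.
Proof.
have [e eC eX] : exists2 e : {rmorphism A -> A},
    forall x, e x%:MP = x%:MP & forall i, e 'X_i = v i.
  exists (mmap (@mpolyC 3 K) v) => [x|i]; first by rewrite /= mmapC.
  by rewrite /= mmapX mmap1U.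
case=> q /(congr1 (map_poly (map_poly e))).
rewrite rmorphM /= map_polyXn => qe; exists (map_poly (map_poly e) q).
rewrite -qe rmorph_mmap; apply: eq_mmap => i /=.
  by rewrite map_polyC /= map_polyC /= eC.
rewrite (rmorphD (map_poly (map_poly e))) (rmorphM (map_poly (map_poly e))) /=.
rewrite !map_polyC map_polyX /= (rmorphM (map_poly e)) /= !map_polyC map_polyX /=.
by rewrite eC eX.
Qed.

End LinearForms.

(** * Incidence of points and lines through cross products *)

Section Incidence.

Local Open Scope ring_scope.
Variable K : fieldType.
Local Notation A := {mpoly K[3]}.
Implicit Types (R L M : 'rV[K]_3) (f g : A).

(** Indices are read modulo 3, which keeps the cross product formulas uniform in the coordinate. *)
Lemma ord3P (k i : 'I_3) : [\/ i = k, i = k + 1 | i = k + 2].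
Proof.
by case: k => -[|[|[|//]]] ?; case: i => -[|[|[|//]]] ?;
  solve [apply: Or31; exact/val_inj | apply: Or32; exact/val_inj
        | apply: Or33; exact/val_inj].
Qed.

Lemma ord3_shift (k : 'I_3) : (k + 1 + 1 = k + 2) * (k + 1 + 2 = k) *
  (k + 2 + 1 = k) * (k + 2 + 2 = k + 1).
Proof. by case: k => -[|[|[|//]]] ?; do !split; apply: val_inj. Qed.

Lemma ord3_neq (k : 'I_3) : ((k == k + 1) = false) * ((k == k + 2) = false) *
  ((k + 1 == k) = false) * ((k + 1 == k + 2) = false) *
  ((k + 2 == k) = false) * ((k + 2 == k + 1) = false).
Proof. by case: k => -[|[|[|//]]] ?; do !split. Qed.

Lemma sum_ord3 (V : nmodType) (k : 'I_3) (F : 'I_3 -> V) :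
  \sum_i F i = F k + F (k + 1) + F (k + 2).
Proof.
rewrite (bigD1 k) //= (bigD1 (k + 1)) /=; last by rewrite ord3_neq.
rewrite (bigD1 (k + 2)) /=; last by rewrite !ord3_neq.
rewrite big1 ?addr0 ?addrA // => i.
by case: (ord3P k i) => ->; rewrite ?ord3_shift !eqxx ?andbF.
Qed.

Definition cross L M : 'rV[K]_3 :=
  \row_i (L 0 (i + 1) * M 0 (i + 2) - L 0 (i + 2) * M 0 (i + 1)).

Lemma dot_crossl L M : dot L (cross L M) = 0.
Proof.
rewrite /dot (sum_ord3 0) !mxE !ord3_shift; ring.
Qed.

Lemma dot_crossr L M : dot M (cross L M) = 0.
Proof.
rewrite /dot (sum_ord3 0) !mxE !ord3_shift; ring.
Qed.

Lemma dot_delta L M j : dot M (cross L (delta_mx 0 j)) = cross M L 0 j.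
Proof.
rewrite /dot (sum_ord3 j) !mxE !ord3_shift !eqxx !ord3_neq /=.
by ring.
Qed.

Lemma crossC L M : cross M L = - cross L M.
Proof. by apply/rowP => i; rewrite !mxE; ring. Qed.

(** If the cross product vanished, every product of [L] with a basis vector would lie on both lines,
    hence be zero or a multiple of [R]. Two of them, at the indices next to a nonzero coordinate of
    [L], are independent. *)
Lemma cross_neq0 L M R : L != 0 -> R != 0 ->
  (forall v, v != 0 -> dot L v = 0 -> dot M v = 0 -> proj_eq v R) ->
  cross M L != 0.
Proof.
move=> L0 R0 LMR; apply/eqP => C0.
have span j : cross L (delta_mx 0 j) != 0 -> exists2 c, c != 0 &
    cross L (delta_mx 0 j) = c *: R.
  move=> u0; have Mu : dot M (cross L (delta_mx 0 j)) = 0 by rewrite dot_delta C0 mxE.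
  by have [c [? ?]] := LMR _ u0 (dot_crossl _ _) Mu; exists c.
have /rV0Pn[k Lk] := L0.
have u0 : cross L (delta_mx 0 (k + 2)) 0 (k + 1) != 0.
  by rewrite !mxE !ord3_shift !eqxx !ord3_neq /= mulr0 mulr1 sub0r oppr_eq0.
have w0 : cross L (delta_mx 0 (k + 1)) 0 (k + 2) != 0.
  by rewrite !mxE !ord3_shift !eqxx !ord3_neq /= mulr0 mulr1 subr0.
have nz (u : 'rV[K]_3) i : u 0 i != 0 -> u != 0.
  by apply: contraNneq => ->; rewrite mxE.
have [c c0 uR] := span _ (nz _ _ u0); have [d _ wR] := span _ (nz _ _ w0).
move/eqP: w0; apply; rewrite wR mxE; apply/eqP; rewrite mulf_eq0; apply/orP; right.
rewrite -(inj_eq (mulfI c0)) mulr0.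
have := congr1 (fun u : 'rV_3 => u 0 (k + 2)) uR; rewrite /= [RHS]mxE => <-.
by rewrite !mxE !ord3_shift !ord3_neq /= !mulr0 subrr.
Qed.

Lemma mmap_congr (I : set A) (w : 'I_3 -> A) f : is_ideal I ->
  (forall i, I ('X_i - w i)) -> I (f - mmap (@mpolyC 3 K) w f).
Proof.
move=> iI Iw; have [I0 ID IM] := iI.
have congM g h g' h' : I (g - g') -> I (h - h') -> I (g * h - g' * h').
  move=> Ig Ih; rewrite (_ : _ - _ = h * (g - g') + g' * (h - h')); last by ring.
  by apply: ID; apply: IM.
rewrite {1}[f]mpolyE /mmap -sumrB; apply: is_ideal_sum => // k _.
rewrite -mul_mpolyC -mulrBr; apply: IM; rewrite mpolyXE_id /mmap1.
elim/big_ind2: _ => [|? ? ? ? ? ?|i _]; [by rewrite subrr | exact: congM |].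
elim: (k i) => [|d IHd]; first by rewrite !expr0 subrr.
by rewrite !exprS; apply: congM.
Qed.

(** A coordinate of the triple product expansion of x × (L × M) in terms of L and M, where x is the
    generic vector. *)
Lemma lform_minors L M (k i : 'I_3) : exists a b : A,
  (cross L M 0 k)%:MP * 'X_i - (cross L M 0 i)%:MP * 'X_k =
    lform L * a + lform M * b.
Proof.
rewrite /lform !(sum_ord3 k) -!mul_mpolyC !mxE.
case: (ord3P k i) => ->; rewrite ?ord3_shift !(mpolyCB, mpolyCM).
- by exists 0, 0; ring.
- by exists (M 0 (k + 2))%:MP, (- (L 0 (k + 2))%:MP); ring.
- by exists (- (M 0 (k + 1))%:MP), (L 0 (k + 1))%:MP; ring.
Qed.

(** Modulo the two forms the generic vector is proportional to [R], by the minors: f is congruent to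
    f(s R) at s = X_k / R_k, for a nonzero coordinate R_k, and this is zero. *)
Lemma cone_eq0_split L M R c f : R != 0 -> c != 0 -> cross L M = c *: R ->
  cone R f = 0 -> exists f1 f2, f = lform L * f1 + lform M * f2.
Proof.
move=> R0 c0 LMR fR.
pose I : set A := [set f | exists f1 f2, f = lform L * f1 + lform M * f2]%classic.
have iI : is_ideal I.
  split=> [|_ _ [a [b ->]] [a' [b' ->]]|g _ [a [b ->]]].
  - by exists 0, 0; ring.
  - by exists (a + a'), (b + b'); ring.
  - by exists (g * a), (g * b); ring.
have /rV0Pn[k Rk] := R0.
have Iw i : I ('X_i - (R 0 i)%:MP * ((R 0 k)^-1 *: 'X_k)).
  have [a [b eab]] := lform_minors L M k i; have [_ _ IM] := iI.
  have : I ((cross L M 0 k)%:MP * 'X_i - (cross L M 0 i)%:MP * 'X_k) by exists a, b.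
  move/(IM (c * R 0 k)^-1%:MP); congr I; rewrite LMR !mxE mulrBr !mulrA -!mpolyCM.
  rewrite mulVf ?mulf_neq0 // mpolyC1 mul1r -[_ *: 'X_k]mul_mpolyC (mulrA (R 0 i)%:MP) -mpolyCM.
  by congr (_ - _%:MP * _); rewrite invfM mulrACA mulVf ?mul1r 1?mulrC.
by have := mmap_congr f iI Iw; rewrite (cone_eval _ fR) subr0.
Qed.

End Incidence.

(** * Grids of lines and generation by products of linear forms *)

Section LineGrid.

Local Open Scope ring_scope.
Variables (K : fieldType) (r s : nat).
Local Notation A := {mpoly K[3]}.

(** The incidence data that the argument takes from the Hadamard products. *)
Record line_grid (L : 'I_r -> 'rV[K]_3) (M : 'I_s -> 'rV[K]_3)
    (R : 'I_r -> 'I_s -> 'rV[K]_3) : Prop := LineGrid {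
  grid_pt_neq0 : forall i j, R i j != 0;
  grid_cross : forall i j, exists2 c, c != 0 & cross (L i) (M j) = c *: R i j;
  grid_dotL : forall i j k, (dot (L k) (R i j) == 0) = (k == i);
  grid_dotM : forall i j l, (dot (M l) (R i j) == 0) = (l == j)
}.

Variables (L : 'I_r -> 'rV[K]_3) (M : 'I_s -> 'rV[K]_3).
Variable R : 'I_r -> 'I_s -> 'rV[K]_3.
Hypothesis grid : line_grid L M R.

Local Notation generic := (fun i : 'I_3 => 'X_i : A).

Lemma grid_cross_neq0 i j : cross (L i) (M j) != 0.
Proof.
by have [c c0 ->] := grid_cross grid i j; rewrite scaler_eq0 negb_or c0 (grid_pt_neq0 grid).
Qed.

Lemma grid_L_neq0 i (j : 'I_s) : L i != 0.
Proof.
apply: contraNneq (grid_cross_neq0 i j) => ->.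
by apply/eqP/rowP => k; rewrite !mxE !mul0r subrr.
Qed.

Lemma grid_M_neq0 (i : 'I_r) j : M j != 0.
Proof.
apply: contraNneq (grid_cross_neq0 i j) => ->.
by apply/eqP/rowP => k; rewrite !mxE !mulr0 subrr.
Qed.

Lemma ord_exact_L i j k : ord_exact (R i j) generic (k == i) (lform (L k)).
Proof.
have [->|ki] := eqVneq k i.
  apply: ord_exact_lform1_generic (grid_L_neq0 i j).
  by apply/eqP; rewrite (grid_dotL grid).
by apply: ord_exact_lform0; rewrite (grid_dotL grid).
Qed.

Lemma ord_exact_M i j l : ord_exact (R i j) generic (l == j) (lform (M l)).
Proof.
have [->|lj] := eqVneq l j.
  apply: ord_exact_lform1_generic (grid_M_neq0 i j).
  by apply/eqP; rewrite (grid_dotM grid).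
by apply: ord_exact_lform0; rewrite (grid_dotM grid).
Qed.

(* The cross product of L i with the generic vector: a generic point of the
   i-th line. *)
Definition on_line (i : 'I_r) (k : 'I_3) : A :=
  (L i 0 (k + 1))%:MP * 'X_(k + 2) - (L i 0 (k + 2))%:MP * 'X_(k + 1).

(** Both [R i j] and the direction are orthogonal to [L i], so the substitution stays on the i-th
    line. *)
Lemma on_line_L i j f : line_subst (R i j) (on_line i) (lform (L i) * f) = 0.
Proof.
rewrite line_substM line_subst_lform; have /eqP-> : dot (L i) (R i j) == 0.
  by rewrite (grid_dotL grid).
rewrite mpolyC0 polyC0 mul0r polyC0 add0r (sum_ord3 0) /on_line !ord3_shift.
by rewrite [X in X%:P](_ : _ = 0) ?polyC0 ?mul0r //; ring.
Qed.

(** The two lines cross transversally: M_j · (L_i × x) = (M_j × L_i) · x is a nonzero linear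
    form. *)
Lemma on_line_M i j l : ord_exact (R i j) (on_line i) (l == j) (lform (M l)).
Proof.
have [->|lj] := eqVneq l j; last first.
  by apply: ord_exact_lform0; rewrite (grid_dotM grid).
apply: ord_exact_lform1; first by apply/eqP; rewrite (grid_dotM grid).
have : lform (cross (M j) (L i)) != 0.
  by apply: lform_neq0; rewrite crossC oppr_eq0 grid_cross_neq0.
rewrite /lform !(sum_ord3 0) !mxE /on_line -!mul_mpolyC !ord3_shift.
by congr (_ != 0); rewrite !(mpolyCB, mpolyCM); ring.
Qed.

(** On the i-th line, prescribed zeros can be divided out one at a time: vanishing at [R i j] puts f
    in the ideal of [L i] and [M j], and the cofactor of [M j] has one zero less at that point. *)
Lemma line_division i (c : 'I_s -> nat) f :
  (forall j, ord (R i j) (on_line i) (c j) f) ->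
  exists g h, f = lform (L i) * g + h * \prod_j lform (M j) ^+ c j.
Proof.
have [N cN] : exists N, (\sum_j c j <= N)%N by exists (\sum_j c j)%N.
elim: N => [|N IHN] in c f cN *; move=> fc.
  exists 0, f; rewrite mulr0 add0r big1 ?mulr1 // => j _.
  by move: cN; rewrite leqn0 sum_nat_eq0 => /forallP/(_ j)/= /eqP ->.
have [/existsP[j cj]|/existsPn c0] := boolP [exists j, c j != 0%N]; last first.
  apply: IHN => //; rewrite big1 // => j _; apply/eqP.
  by move: (c0 j); rewrite negbK.
have {}cj : (0 < c j)%N by rewrite lt0n.
have /ord1P fj : ord (R i j) (on_line i) 1 f by apply: ord_sub (fc j).
have [d d0 LMR] := grid_cross grid i j.
have [g [h fE]] := cone_eq0_split (grid_pt_neq0 grid i j) d0 LMR fj.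
(* The multiple of [L i] restricts to zero, so the order of f is that of the multiple of [M j]. *)
have hc l : ord (R i l) (on_line i) (c l - (j == l)) h.
  apply: ord_cancel (on_line_M i l j) _.
  have := fc l; rewrite /ord fE line_substD.
  by rewrite on_line_L add0r.
have [|g' [h' hE]] := IHN _ h _ hc.
  rewrite -ltnS (leq_trans _ cN) // [X in (_ < X)%N](bigD1 j) //= (bigD1 j) //= eqxx.
  rewrite -addSn leq_add //; first by rewrite subn1 prednK.
  by apply: leq_sum => l _; rewrite leq_subr.
exists (g + lform (M j) * g'), h'.
have -> : \prod_l lform (M l) ^+ c l =
    lform (M j) * \prod_l lform (M l) ^+ (c l - (j == l)).
  rewrite (bigD1 j) //= [in RHS](bigD1 j) //= eqxx mulrA -exprS subn1 prednK //.
  congr (_ * _); apply: eq_bigr => l lj.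
  by rewrite eq_sym (negbTE lj) subn0.
by rewrite fE hE; ring.
Qed.

Definition grid_gen (p : 'I_r -> nat) (w : 'I_s -> nat) (u : nat) : A :=
  \prod_i lform (L i) ^+ (p i - u) * \prod_j lform (M j) ^+ (u - w j).

(** Only the lines [L i] and [M j] pass through [R i j]. The order is at least [p i - w j], with
    equality at [u = w j]. *)
Lemma ord_exact_grid_gen p w u i j :
  ord_exact (R i j) generic ((p i - u) + (u - w j)) (grid_gen p w u).
Proof.
apply: ord_exactM.
  rewrite (bigD1 i) //= -[X in ord_exact _ _ X]addn0; apply: ord_exactM.
    by have := ord_exactX (p i - u) (ord_exact_L i j i); rewrite eqxx mul1n.
  apply: ord_exact_prod0 => k ki.
  by have := ord_exactX (p k - u) (ord_exact_L i j k); rewrite (negbTE ki) mul0n.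
rewrite (bigD1 j) //= -[X in ord_exact _ _ X]addn0; apply: ord_exactM.
  by have := ord_exactX (u - w j) (ord_exact_M i j j); rewrite eqxx mul1n.
apply: ord_exact_prod0 => l lj.
by have := ord_exactX (u - w l) (ord_exact_M i j l); rewrite (negbTE lj) mul0n.
Qed.

(** The ideal [I] is arbitrary for two reasons: the induction on the sum of the [p i] replaces it by
    its colon ideal by [L i], and the result serves both the fat point ideal and its powers. *)
Lemma grid_generation (p : 'I_r -> nat) (w : 'I_s -> nat) (I : set A) f :
  is_ideal I -> (forall u, I (grid_gen p w u)) ->
  (forall i j, ord (R i j) generic (p i - w j) f) -> I f.
Proof.
have [N pN] : exists N, (\sum_i p i <= N)%N by exists (\sum_i p i)%N.
elim: N => [|N IHN] in p I f pN *; move=> iI Ig fp; have [I0 ID IM] := iI.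
  have p0 i : p i = 0%N.
    by move: pN; rewrite leqn0 sum_nat_eq0 => /forallP/(_ i)/= /eqP.
  suff g1 : grid_gen p w 0 = 1 by rewrite -[f]mulr1 -g1; apply/IM/Ig.
  by rewrite /grid_gen !big1 ?mulr1 // => i _; rewrite ?p0 ?sub0n.
have [/existsP[i0 _]|/existsPn p0] := boolP [exists i, p i != 0%N]; last first.
  apply: (IHN p) => //; rewrite big1 // => i _; apply/eqP.
  by move: (p0 i); rewrite negbK.
case: (@arg_maxnP _ i0 predT p isT) => i _ pmax.
have [pi0|pi_gt0] := posnP (p i).
  apply: (IHN p) => //; rewrite big1 // => k _; apply/eqP.
  by rewrite -leqn0 -pi0; apply: pmax.
have [|g [h fE]] := @line_division i (fun j => p i - w j)%N f.
  by move=> j; apply/ord_specialize/fp.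
(* By maximality of [p i] all exponents [p k - p i] truncate to 0. *)
have gen_pi : grid_gen p w (p i) = \prod_j lform (M j) ^+ (p i - w j).
  rewrite /grid_gen big1 ?mul1r // => k _.
  have : (p k <= p i)%N := pmax k isT.
  by rewrite -subn_eq0 => /eqP->.
rewrite -gen_pi in fE; rewrite fE; apply: ID; last exact/IM.
(* The subtracted multiple of the generator has order at least [p k - w l], and dividing by [L i]
   costs one order only on the i-th line. *)
have gp k l : ord (R k l) generic ((p k - (i == k)) - w l) g.
  rewrite subnAC; apply: ord_cancel (ord_exact_L k l i) _.
  have [_ JD JM] := ord_ideal (R k l) generic (p k - w l).
  have -> : lform (L i) * g = f - h * grid_gen p w (p i) by rewrite fE addrK.
  apply: is_idealB (ord_ideal _ _ _) (fp k l) _; apply: JM.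
  have /ord_exactW := ord_exact_grid_gen p w (p i) k l; apply: ord_sub.
  by have : (p k <= p i)%N := pmax k isT; lia.
pose I' : set A := [set x | I (lform (L i) * x)]%classic.
apply: (IHN (fun k => p k - (i == k))%N I' g) => //.
- rewrite -ltnS (leq_trans _ pN) // [X in (_ < X)%N](bigD1 i) //= (bigD1 i) //= eqxx.
  rewrite -addSn leq_add //; first by rewrite subn1 prednK.
  by apply: leq_sum => l _; rewrite leq_subr.
- exact: mul_preim_ideal.
move=> u; rewrite /I' /=.
suff [x ->] : exists x, lform (L i) * grid_gen (fun k => p k - (i == k))%N w u =
    x * grid_gen p w u by apply: IM.
(* This is 0 for u < [p i], where the generators match exactly, and 1 otherwise, where both
   exponents truncate to 0 and the extra [L i] remains. *)
pose e := ((p i - 1 - u).+1 - (p i - u))%N.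
exists (lform (L i) ^+ e); rewrite /grid_gen !mulrA; congr (_ * _).
rewrite (bigD1 i) //= [in RHS](bigD1 i) //= eqxx !mulrA -exprS -exprD.
congr (_ ^+ _ * _); first by rewrite /e; lia.
by apply: eq_bigr => k ki; rewrite eq_sym (negbTE ki) subn0.
Qed.

End LineGrid.

(** * Ordinary and symbolic powers of the grid ideal *)

Section GridPowers.

Local Open Scope ring_scope.
Variables (K : fieldType).
Local Notation A := {mpoly K[3]}.
Local Notation generic := (fun i : 'I_3 => 'X_i : A).

Lemma ideal_pow_ord (R : 'rV[K]_3) c (I : set A) a :
  (I `<=` ord R generic c -> ideal_pow I a `<=` ord R generic (a * c))%classic.
Proof.
move=> Ic; apply: ideal_gen_min; first exact: ord_ideal.
by move=> _ [g [Ig ->]]; apply: ord_prod => t; apply: Ic.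
Qed.

Lemma point_ideal_ord (R : 'rV[K]_3) c :
  (ideal_pow (point_ideal R) c `<=` ord R generic c)%classic.
Proof.
rewrite -[X in ord _ _ X]muln1; apply: ideal_pow_ord.
apply: ideal_gen_min; first exact: ord_ideal.
by move=> f [[d fd] fR]; apply/ord1P/(cone_homog fd).
Qed.

Lemma lform_point_ideal (R L : 'rV[K]_3) : dot L R = 0 -> point_ideal R (lform L).
Proof.
move=> LR; apply: ideal_gen_incl; split; first by exists 1%N; apply: lform_homog.
by rewrite /meval mmap_lform.
Qed.

(** This is the kernel of [cone R], a ring morphism into a domain. *)
Lemma ord1_prime (R : 'rV[K]_3) : is_prime_ideal (ord R generic 1 : set A).
Proof.
split; first exact: ord_ideal.
  by rewrite ord1P rmorph1; apply/eqP/oner_neq0.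
move=> f g; rewrite !ord1P rmorphM => /eqP; rewrite mulf_eq0.
by case/orP => /eqP; [left | right].
Qed.

Variables (r s : nat) (L : 'I_r -> 'rV[K]_3) (M : 'I_s -> 'rV[K]_3).
Variable R : 'I_r -> 'I_s -> 'rV[K]_3.
Hypothesis grid : line_grid L M R.
Variables (p : 'I_r -> nat) (w : 'I_s -> nat).

Definition grid_ideal : set A :=
  [set f | forall i j, ideal_pow (point_ideal (R i j)) (p i - w j) f]%classic.

Lemma grid_ideal_ideal : is_ideal grid_ideal.
Proof.
split=> [i j|f g If Ig i j|f g Ig i j];
  have [J0 JD JM] := ideal_pow_ideal (point_ideal (R i j)) (p i - w j) => //.
  by apply: JD; [apply: If | apply: Ig].
by apply: JM; apply: Ig.
Qed.

Lemma grid_gen_in u : grid_ideal (grid_gen L M p w u).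
Proof.
move=> i j.
have [_ _ JM] := ideal_pow_ideal (point_ideal (R i j)) (p i - w j).
rewrite /grid_gen (bigD1 i) //= [X in _ * X](bigD1 j) //= mulrACA mulrC; apply: JM.
apply: (@ideal_pow_sub _ _ ((p i - u) + (u - w j))); first lia.
apply: ideal_powM; apply: ideal_pow_exp; apply: lform_point_ideal; apply/eqP.
  by rewrite (grid_dotL grid).
by rewrite (grid_dotM grid).
Qed.

Lemma grid_ideal_ord i j : (grid_ideal `<=` ord (R i j) generic (p i - w j))%classic.
Proof. by move=> f /(_ i j); apply: point_ideal_ord. Qed.

(** Membership becomes a condition on orders, where factors of known exact order can be
    cancelled. *)
Lemma grid_idealP f :
  grid_ideal f <-> forall i j, ord (R i j) generic (p i - w j) f.
Proof.
split=> [If i j|]; first exact: grid_ideal_ord.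
exact: (grid_generation grid grid_ideal_ideal grid_gen_in).
Qed.

(* With u = a k + e and e < a, the numbers p i - k and p i - (k + 1) never have
   opposite signs, so the truncated sum (a - e) (p i - k) + e (p i - (k + 1))
   is a p i - u; likewise for w. *)
Lemma grid_gen_pow a u : (0 < a)%N ->
  ideal_pow grid_ideal a (grid_gen L M (fun i => a * p i)%N (fun j => a * w j)%N u).
Proof.
move=> a0; pose k := (u %/ a)%N; pose e := (u %% a)%N.
have le_ea : (e <= a)%N by rewrite ltnW // ltn_mod.
suff -> : grid_gen L M (fun i => a * p i)%N (fun j => a * w j)%N u =
    grid_gen L M p w k ^+ (a - e) * grid_gen L M p w k.+1 ^+ e.
  rewrite -{1}(subnK le_ea); apply: ideal_powM; exact/ideal_pow_exp/grid_gen_in.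
rewrite /grid_gen !exprMn mulrACA -!prodrXl -!big_split /=.
have uE : u = (k * a + e)%N := divn_eq u a.
congr (_ * _); apply: eq_bigr => i _; rewrite -!exprM -exprD; congr (_ ^+ _).
  rewrite uE; have [le_pk|lt_kp] := leqP (p i) k.
    have : (a * p i <= k * a)%N by rewrite mulnC leq_mul2r le_pk orbT.
    by nia.
  by nia.
rewrite uE; have [le_wk|lt_kw] := leqP (w i) k; by nia.
Qed.

(** Scaling [p] and [w] by [a] scales every multiplicity by [a], so generation for the scaled data
    describes the a-th power. *)
Lemma grid_ideal_powP a f : (0 < a)%N ->
  ideal_pow grid_ideal a f <-> forall i j, ord (R i j) generic (a * (p i - w j)) f.
Proof.
move=> a0; split=> [fI i j|fo].
  by move: f fI; apply/ideal_pow_ord/grid_ideal_ord.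
apply: (grid_generation grid (ideal_pow_ideal _ a) (fun u => grid_gen_pow u a0)).
by move=> i j; rewrite -mulnBr.
Qed.

Hypothesis pw_gt0 : forall i j, (0 < p i - w j)%N.

(* The witness vanishes to order exactly (p i - w j) - 1 at R i j and to order
   at least N, an upper bound of the multiplicities, at the other points. *)
Lemma ord1_associated i j : associated_prime grid_ideal (ord (R i j) generic 1).
Proof.
split; first exact: ord1_prime.
pose c := (p i - w j)%N; pose N := (\sum_i p i)%N.
have pN k : (p k <= N)%N by rewrite /N (bigD1 k) //= leq_addr.
pose g := lform (L i) ^+ c.-1 * (\prod_(k | k != i) lform (L k) ^+ N *
  \prod_(l | l != j) lform (M l) ^+ N).
have gE : ord_exact (R i j) generic c.-1 g.
  rewrite -[X in ord_exact _ _ X]addn0; apply: ord_exactM.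
    by have := ord_exactX c.-1 (ord_exact_L grid i j i); rewrite eqxx mul1n.
  rewrite -[X in ord_exact _ _ X]addn0; apply: ord_exactM;
    apply: ord_exact_prod0 => k kn.
    by have := ord_exactX N (ord_exact_L grid i j k); rewrite (negbTE kn) mul0n.
  by have := ord_exactX N (ord_exact_M grid i j k); rewrite (negbTE kn) mul0n.
have gN k l : (k, l) != (i, j) -> ord (R k l) generic N g.
  move=> kl; have [_ _ JM] := ord_ideal (R k l) generic N.
  have [ki|ki] := eqVneq k i.
    have lj : l != j by apply: contra kl => /eqP->; rewrite ki.
    apply/JM/JM; rewrite (bigD1 l) //= mulrC; apply: JM.
    have := ord_exactX N (ord_exact_M grid k l l); rewrite eqxx mul1n.
    exact: ord_exactW.
  apply: (JM); rewrite (bigD1 k) //= -mulrA mulrC; apply: JM.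
  have := ord_exactX N (ord_exact_L grid k l k); rewrite eqxx mul1n.
  exact: ord_exactW.
exists g; apply/seteqP; split=> f; rewrite /colon /= grid_idealP; last first.
  move=> fg; have := fg i j; rewrite mulrC => /(ord_cancel gE); apply: ord_sub.
  by have := pw_gt0 i j; rewrite -/c; case: (c) => // d _; rewrite subSnn.
move=> f1 k l; have [[-> ->]|kl] := eqVneq (k, l) (i, j).
  have -> : (p i - w j = 1 + c.-1)%N by rewrite add1n prednK // pw_gt0.
  exact/(ordM f1)/ord_exactW.
have [_ _ JM] := ord_ideal (R k l) generic (p k - w l).
apply: JM; apply: ord_sub (gN _ _ kl).
by apply: leq_trans (pN k); apply: leq_subr.
Qed.

(** Each point gives an associated prime. A multiplier outside it has order exactly 0 at that point
    and can be cancelled there. *)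
Lemma grid_ideal_symbolic a : (0 < a)%N ->
  (symbolic_pow grid_ideal a `<=` ideal_pow grid_ideal a)%classic.
Proof.
move=> a0 f fs; apply/(grid_ideal_powP _ a0) => i j.
have [t [t1 /(grid_ideal_powP _ a0)/(_ i j) tf]] := fs _ (ord1_associated i j).
rewrite -[X in ord _ _ X]subn0; apply: ord_cancel tf; apply/ord_exact0P.
by apply/eqP => /ord1P.
Qed.

(** The generator with [u = w j] has the least order allowed at [R i j]; its a-th power has too
    small an order there for the next power. *)
Lemma grid_ideal_not_symbolic a : 'I_r -> 'I_s ->
  ~ (symbolic_pow grid_ideal a `<=` ideal_pow grid_ideal a.+1)%classic.
Proof.
move=> i j sub; pose g := grid_gen L M p w (w j).
have /(sub _) : symbolic_pow grid_ideal a (g ^+ a).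
  move=> q [[_ q1 _] _]; exists 1; split=> //; rewrite mul1r.
  exact/ideal_pow_exp/grid_gen_in.
(* Cancelling [g ^+ a] from its product with 1 would leave 1 with positive order. *)
move/(grid_ideal_powP _ (ltn0Sn a))/(_ i j); rewrite -[g ^+ a]mulr1.
have := ord_exactX a (ord_exact_grid_gen grid p w (w j) i j).
rewrite subnn addn0 => /ord_cancel/[apply]; rewrite mulSn mulnC addnK.
have [_ n1 _] := ord1_prime (R i j).
by move/(ord_sub (pw_gt0 i j)).
Qed.

End GridPowers.

(** * From Hadamard products to a grid of lines *)

Section HadamardGrid.

Local Open Scope ring_scope.
Variable K : fieldType.

(** For [p] off the coordinate lines this gives both the coefficients of the transformed line and
    the preimage of a point. *)
Definition hdiv (a p : 'rV[K]_3) : 'rV[K]_3 := \row_i (a 0 i / p 0 i).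

Lemma hdiv_neq0 a p : off_Delta1 p -> a != 0 -> hdiv a p != 0.
Proof.
move=> p0 /rV0Pn[i ai]; apply/rV0Pn; exists i.
by rewrite mxE mulf_neq0 ?invr_eq0.
Qed.

Lemma hlineE (a p : 'rV[K]_3) : off_Delta1 p ->
  hline [set v : 'rV[K]_3 | v != 0 /\ \sum_i a 0 i * v 0 i = 0]%classic p =
  [set v : 'rV[K]_3 | v != 0 /\ dot (hdiv a p) v = 0]%classic.
Proof.
move=> p0; apply/seteqP; split=> [_ [v [/rV0Pn[i vi] av] <-]|v [v0 av]] /=.
  split; first by apply/rV0Pn; exists i; rewrite mxE mulf_neq0.
  by rewrite -[RHS]av; apply: eq_bigr => k _; rewrite !mxE mulrCA mulrVK ?unitfE // mulrC.
exists (hdiv v p); last by apply/rowP => k; rewrite !mxE mulrVK ?unitfE.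
split; first exact: hdiv_neq0.
by rewrite -[RHS]av; apply: eq_bigr => k _; rewrite !mxE mulrAC mulrA.
Qed.

(** By the complete intersection property, [R i j] is the only common point of its two lines. Were
    it also on [L k], it would be [R k j], which forces k = i; likewise for [M l]. *)
Lemma hadamard_line_grid r s (P : 'I_r -> 'rV[K]_3) (Q : 'I_s -> 'rV[K]_3)
    (lP lQ : set 'rV[K]_3) (m : 'I_r -> nat) (n : 'I_s -> nat) :
  hadamard_fat_grid P Q lP lQ m n ->
  exists L M, line_grid L M (fun i j => hprod (P i) (Q j)).
Proof.
case=> _ _ [a [a0 ->]] [b [b0 ->]] _ _ P0 Q0 _ _ _ _ _ _ _ [_ _ injR ciE].
pose R i j := hprod (P i) (Q j); pose L i := hdiv b (P i); pose M j := hdiv a (Q j).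
have R0 i j : R i j != 0.
  by apply/rV0Pn; exists 0; rewrite mxE mulf_neq0 ?P0 ?Q0.
have LMR i j v : v != 0 /\ dot (L i) v = 0 /\ dot (M j) v = 0 <-> proj_eq v (R i j).
  have := ciE i j; rewrite !hlineE // => /seteqP[sub1 sub2].
  by split=> [[v0 [Lv Mv]]|/sub2[[v0 Lv] [_ Mv]]] //; apply: sub1.
have LMR0 i j : dot (L i) (R i j) = 0 /\ dot (M j) (R i j) = 0.
  have [] := (LMR i j (R i j)).2 => //.
  by exists 1; rewrite oner_neq0 scale1r.
exists L, M; split=> //.
- move=> i j; have C0 : cross (L i) (M j) != 0.
    rewrite crossC oppr_eq0; apply: (@cross_neq0 _ _ _ (R i j)).
    + exact: hdiv_neq0.
    + exact: R0.
    + by move=> v v0 Lv Mv; apply/LMR.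
  have [|c [c0 ->]] := (LMR i j (cross (L i) (M j))).1; last by exists c.
  by rewrite dot_crossl dot_crossr.
- move=> i j k; apply/eqP/eqP => [Lk|->]; last by case: (LMR0 i j).
  have /injR[] // : proj_eq (R i j) (R k j).
  by apply/LMR; split=> //; split=> //; case: (LMR0 i j).
- move=> i j l; apply/eqP/eqP => [Ml|->]; last by case: (LMR0 i j).
  have /injR[] // : proj_eq (R i j) (R i l).
  by apply/LMR; split=> //; split=> //; case: (LMR0 i j).
Qed.

End HadamardGrid.

Theorem corollary5p19 (R : realType) (K : closedFieldType) (r s : nat)
  (P : 'I_r -> 'rV[K]_3) (Q : 'I_s -> 'rV[K]_3)
  (lP lQ : set 'rV[K]_3) (m : 'I_r -> nat) (n : 'I_s -> nat)
  (HFG : hadamard_fat_grid P Q lP lQ m n) :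
  resurgence R (hfg_ideal P Q m n) = 1%E.
Proof.
have [L [M grid]] := hadamard_line_grid HFG.
pose N := (\sum_j n j)%N.
(* Since [n j] is at most [N], the difference defining [w j] does not truncate. *)
pose p i := (m i + N)%N; pose w j := (N.+1 - n j)%N.
have pwE i j : (p i - w j = m i + n j - 1)%N.
  have : (n j <= N)%N by rewrite /N (bigD1 j) //= leq_addr.
  by rewrite /p /w; have := hfg_n_gt0 HFG j; lia.
have pw_gt0 i j : (0 < p i - w j)%N.
  by rewrite pwE; have := hfg_m_gt0 HFG i; have := hfg_n_gt0 HFG j; lia.
have -> : hfg_ideal P Q m n = grid_ideal (fun i j => hprod (P i) (Q j)) p w.
  by apply/seteqP; split=> f /= fI i j; have := fI i j; rewrite pwE.
have r0 := hfg_r_gt0 HFG; have s0 := leq_trans r0 (hfg_le_rs HFG).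
apply: resurgence_eq1.
  by move=> a a0; apply: (grid_ideal_symbolic grid).
move=> a _; exact: (grid_ideal_not_symbolic grid pw_gt0 (Ordinal r0) (Ordinal s0)).
Qed.
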